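(* There are liftable bounded linear operators $T:\ell_\infty/c_0\rightarrow\ell_\infty/c_0$ such that no lifting of $T$ is continuous on $B_{\ell_\infty}$ in the product topology, and $T$ is not a matrix operator. Moreover, such operators can be automorphisms of $\ell_\infty/c_0$.
   Context: Operators are bounded and linear; $[f]$ is the class of $f$ modulo null functions; $B_{\ell_\infty}$ is the unit ball of $\ell_\infty$. A lifting of $T:\ell_\infty/c_0\rightarrow\ell_\infty/c_0$ is a bounded linear operator $R:\ell_\infty\to\ell_\infty$ with $R[c_0]\subseteq c_0$ and $T([f])=[R(f)]$ for all $f\in\ell_\infty$; $T$ is liftable if it has a lifting. Continuity of $R$ on $B_{\ell_\infty}$ in the product topology means that $R|B_{\ell_\infty}:B_{\ell_\infty}\to\ell_\infty$ is continuous when both sets carry the topology inherited from $\mathbb{R}^{\mathbb{N}}$. $T$ is a matrix operator if there are cofinite $A,B\subseteq\mathbb{N}$ and a real matrix $(b_{ij})_{i\in B,j\in A}$ defining a bounded operator $c_0(A)\to c_0(B)$ such that $T([f])=[(\sum_{j\in A}b_{ij}f(j))_{i\in B}]$ for all $f\in\ell_\infty(A)$ (identifying $\ell_\infty(A)/c_0(A)$ and $\ell_\infty(B)/c_0(B)$ with $\ell_\infty/c_0$). An automorphism is a bounded linear bijection of the space onto itself (with bounded inverse). *)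

(* Defs.v *)
From HB Require Import structures.
From mathcomp Require Import all_boot all_order all_algebra.
From mathcomp Require Import all_classical all_reals all_analysis.

Set Implicit Arguments.
Unset Strict Implicit.
Unset Printing Implicit Defensive.

Import Order.TTheory GRing.Theory Num.Theory.
Import numFieldNormedType.Exports.

Local Open Scope classical_set_scope.
Local Open Scope ring_scope.
Local Open Scope quotient_scope.

Section Linf.
Variable R : realType.

Definition bounded_seq : {pred nat -> R} :=
  mem (bounded_fun : set (nat -> R)).

Lemma bounded_seqP (u : nat -> R) :
  reflect (exists M, forall n, `|u n| <= M) (u \in bounded_seq).
Proof.
apply: (iffP idP) => [|[M uM]].
  rewrite inE => /= /pinfty_ex_gt0 [M _ uM].
  by exists M => n; exact: uM.
rewrite inE /=; apply/ex_bound; first exact: (globally_properfilter (a := 0%N)).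
by exists M => n _; exact: uM.
Qed.

Lemma bounded_seq_submod_closed : submod_closed bounded_seq.
Proof.
split=> [|a u v /bounded_seqP[M uM] /bounded_seqP[N vN]].
  by apply/bounded_seqP; exists 0 => n; rewrite normr0.
apply/bounded_seqP; exists (`|a| * M + N) => n.
rewrite (le_trans (ler_normD _ _))// lerD// normrM.
by rewrite ler_wpM2l.
Qed.

HB.instance Definition _ := GRing.isSubmodClosed.Build R (nat -> R) bounded_seq
  bounded_seq_submod_closed.

Record linf := Linf { linf_val :> nat -> R ; _ : linf_val \in bounded_seq }.

HB.instance Definition _ := [isSub for linf_val].
HB.instance Definition _ := [Choice of linf by <:].
HB.instance Definition _ := [SubChoice_isSubLmodule of linf by <:].

Definition linf_norm (f : linf) : R := sup (range (fun n => `|f n|)).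

Lemma linf_has_sup (f : linf) : has_sup (range (fun n => `|f n|)).
Proof.
split; first by exists `|f 0%N|, 0%N.
have /bounded_seqP[M fM] := valP f.
by exists M => _ [n _ <-]; exact: fM.
Qed.

Lemma le_linf_norm (f : linf) n : `|f n| <= linf_norm f.
Proof. by apply: sup_upper_bound; [exact: linf_has_sup | exists n]. Qed.

Lemma linf_norm_le (f : linf) M : (forall n, `|f n| <= M) -> linf_norm f <= M.
Proof.
move=> fM; apply: ge_sup; first by case: (linf_has_sup f).
by move=> _ [n _ <-].
Qed.

Lemma linf_norm_ge0 f : 0 <= linf_norm f.
Proof. exact: le_trans (normr_ge0 _) (le_linf_norm f 0%N). Qed.

Lemma linf_normD f g : linf_norm (f + g) <= linf_norm f + linf_norm g.
Proof.
apply: linf_norm_le => n.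
by rewrite (le_trans (ler_normD _ _))// lerD// le_linf_norm.
Qed.

Lemma linf_normZ_le a f : linf_norm (a *: f) <= `|a| * linf_norm f.
Proof.
by apply: linf_norm_le => n; rewrite normrM ler_wpM2l// le_linf_norm.
Qed.

Lemma linf_normZ a f : linf_norm (a *: f) = `|a| * linf_norm f.
Proof.
apply/eqP; rewrite eq_le linf_normZ_le /=.
have [->|a0] := eqVneq a 0; first by rewrite normr0 mul0r linf_norm_ge0.
rewrite -ler_pdivlMl ?normr_gt0// -normfV.
by rewrite -{1}(scalerK a0 f) linf_normZ_le.
Qed.

Lemma linf_norm0_eq0 f : linf_norm f = 0 -> f = 0.
Proof.
move=> f0; apply/val_inj/funext => n /=.
by apply/eqP; rewrite -normr_le0 -f0 le_linf_norm.
Qed.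

HB.instance Definition _ :=
  @Lmodule_isNormed.Build R linf linf_norm linf_normD linf_normZ linf_norm0_eq0.

End Linf.

Section Quotient.
Variable R : realType.

Definition c0 : set (linf R) := [set f | (f : nat -> R) @ \oo --> (0 : R)].

Definition c0_pred : {pred linf R} := mem c0.

Lemma c0_submod_closed : submod_closed c0_pred.
Proof.
split=> [|a f g]; first by rewrite inE; exact: cvg_cst.
rewrite !inE => f0 g0; rewrite /c0/=.
rewrite -[0](addr0 (0 : R)) -{1}(mulr0 a).
by apply: cvgD => //; apply: cvgMr.
Qed.

HB.instance Definition _ := GRing.isSubmodClosed.Build R (linf R) c0_pred
  c0_submod_closed.

Definition linf_c0 : Type := Quotient.quot c0_pred.

HB.instance Definition _ := GRing.Zmodule.on linf_c0.
HB.instance Definition _ := EqQuotient.on linf_c0.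

Definition linf_cls (f : linf R) : linf_c0 := \pi_linf_c0 f.

Lemma linf_clsP (f g : linf R) : linf_cls f = linf_cls g <-> c0 (f - g).
Proof.
split=> [/eqP|fg].
  by rewrite /linf_cls -Quotient.idealrBE inE.
by apply/eqP; rewrite /linf_cls -Quotient.idealrBE inE.
Qed.

Lemma linf_cls_surj (x : linf_c0) : exists f, linf_cls f = x.
Proof. by exists (repr x); exact: reprK. Qed.

Lemma linf_cls_is_zmod_morphism : zmod_morphism linf_cls.
Proof. by move=> f g; exact: (raddfB (\pi_(Quotient.quot c0_pred))). Qed.

HB.instance Definition _ := GRing.isZmodMorphism.Build (linf R) linf_c0 linf_cls
  linf_cls_is_zmod_morphism.

Definition linf_c0_scale (a : R) (x : linf_c0) : linf_c0 :=
  linf_cls (a *: repr x).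

Lemma linf_c0_scaleE a f : linf_c0_scale a (linf_cls f) = linf_cls (a *: f).
Proof.
apply/linf_clsP; rewrite -scalerBr.
have : c0 (repr (linf_cls f) - f) by apply/linf_clsP; exact: reprK.
rewrite -!(in_setE c0) => h.
by apply: (rpredZ (s := c0_pred)).
Qed.

Lemma linf_c0_scaleA a b x :
  linf_c0_scale a (linf_c0_scale b x) = linf_c0_scale (a * b) x.
Proof.
by have [f <-] := linf_cls_surj x; rewrite !linf_c0_scaleE scalerA.
Qed.

Lemma linf_c0_scale1 : left_id 1 linf_c0_scale.
Proof.
by move=> x; have [f <-] := linf_cls_surj x; rewrite linf_c0_scaleE scale1r.
Qed.

Lemma linf_c0_scaleDr : right_distributive linf_c0_scale +%R.
Proof.
move=> a x y; have [f <-] := linf_cls_surj x; have [g <-] := linf_cls_surj y.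
by rewrite -raddfD !linf_c0_scaleE scalerDr raddfD.
Qed.

Lemma linf_c0_scaleDl x :
  {morph linf_c0_scale^~ x : a b / a + b >-> a + b}.
Proof.
move=> a b; have [f <-] := linf_cls_surj x.
by rewrite !linf_c0_scaleE scalerDl raddfD.
Qed.

HB.instance Definition _ := GRing.Zmodule_isLmodule.Build R linf_c0
  linf_c0_scaleA linf_c0_scale1 linf_c0_scaleDr linf_c0_scaleDl.

Lemma linf_cls_scalable : scalable linf_cls.
Proof. by move=> a f; rewrite -linf_c0_scaleE. Qed.

HB.instance Definition _ := GRing.isScalable.Build R (linf R) linf_c0 *:%R
  linf_cls linf_cls_scalable.

Definition linf_c0_norm (x : linf_c0) : R :=
  inf [set `|f| | f in [set f : linf R | linf_cls f = x]].

Lemma linf_c0_has_inf x :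
  has_inf [set `|f| | f in [set f : linf R | linf_cls f = x]].
Proof.
split; first by have [f fx] := linf_cls_surj x; exists `|f|, f.
by exists 0 => _ [f _ <-].
Qed.

Lemma linf_c0_norm_le f : linf_c0_norm (linf_cls f) <= `|f|.
Proof.
by apply: ge_inf; [case: (linf_c0_has_inf (linf_cls f)) | exists f].
Qed.

Lemma linf_c0_norm_ge0 x : 0 <= linf_c0_norm x.
Proof.
apply: lb_le_inf; first by case: (linf_c0_has_inf x).
by move=> _ [f _ <-].
Qed.

Lemma linf_c0_norm_adherent x (e : R) : 0 < e ->
  exists2 f, linf_cls f = x & `|f| < linf_c0_norm x + e.
Proof.
move=> e0; have [_ [f fx <-] fe] := inf_adherent e0 (linf_c0_has_inf x).
by exists f.
Qed.

Lemma linf_c0_normD x y :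
  linf_c0_norm (x + y) <= linf_c0_norm x + linf_c0_norm y.
Proof.
apply/ler_addgt0Pr => e e0.
have e20 : 0 < e / 2 by rewrite divr_gt0.
have [f <- fe] := linf_c0_norm_adherent x e20.
have [g <- ge] := linf_c0_norm_adherent y e20.
rewrite -raddfD (le_trans (linf_c0_norm_le _))//.
rewrite (le_trans (ler_normD _ _))// [e]splitr addrACA.
by rewrite lerD// ltW.
Qed.

Lemma linf_c0_normZ_le a x : linf_c0_norm (a *: x) <= `|a| * linf_c0_norm x.
Proof.
apply/ler_addgt0Pr => e e0.
have a1 : 0 < `|a| + 1 by rewrite ltr_wpDl.
have [f <- fe] := linf_c0_norm_adherent x (divr_gt0 e0 a1).
rewrite -linearZ /= (le_trans (linf_c0_norm_le _))// normrZ.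
rewrite (le_trans (ler_wpM2l (normr_ge0 a) (ltW fe)))// mulrDr lerD2l.
by rewrite mulrCA ger_pMr// ler_pdivrMr// mul1r lerDl.
Qed.

Lemma linf_c0_normZ a x : linf_c0_norm (a *: x) = `|a| * linf_c0_norm x.
Proof.
apply/eqP; rewrite eq_le linf_c0_normZ_le /=.
have [->|a0] := eqVneq a 0; first by rewrite normr0 mul0r linf_c0_norm_ge0.
rewrite -ler_pdivlMl ?normr_gt0// -normfV.
by rewrite -{1}(scalerK a0 x) linf_c0_normZ_le.
Qed.

Lemma linf_c0_norm0_eq0 x : linf_c0_norm x = 0 -> x = 0.
Proof.
have [f <-] := linf_cls_surj x => f0.
rewrite -(raddf0 linf_cls); apply/linf_clsP; rewrite subr0.
apply/cvgrPdist_le => e e0.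
have e20 : 0 < e / 2 by rewrite divr_gt0.
have [g gf ge] := linf_c0_norm_adherent (linf_cls f) e20.
rewrite f0 add0r in ge.
have /linf_clsP/cvgrPdist_le/(_ _ e20) := esym gf.
apply: filterS => n /=; rewrite !sub0r !normrN => fg.
rewrite -(subrK (g n) (f n)) (le_trans (ler_normD _ _))// [e]splitr lerD//.
exact: le_trans (le_linf_norm g n) (ltW ge).
Qed.

HB.instance Definition _ := @Lmodule_isNormed.Build R linf_c0 linf_c0_norm
  linf_c0_normD linf_c0_normZ linf_c0_norm0_eq0.

End Quotient.

Definition bounded_operator (R : realType) (V W : normedModType R)
    (T : {linear V -> W}) : Prop :=
  exists M : R, forall x, `|T x| <= M * `|x|.

Definition automorphism (R : realType) (V : normedModType R)
    (T : {linear V -> V}) : Prop :=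
  bounded_operator T /\
  exists S : {linear V -> V}, [/\ bounded_operator S, cancel T S & cancel S T].

Section Operators.
Variable R : realType.

Definition lifting (T : {linear linf_c0 R -> linf_c0 R})
    (S : {linear linf R -> linf R}) : Prop :=
  [/\ bounded_operator S,
      S @` @c0 R `<=` @c0 R &
      forall f, T (linf_cls f) = linf_cls (S f)].

Definition liftable (T : {linear linf_c0 R -> linf_c0 R}) : Prop :=
  exists S, lifting T S.

(* {ptws nat -> R} is R^N with the product topology; this replaces the norm
   topology that [linf] itself carries. *)
Definition linf_prod : Type :=
  initial_topology (fun f : linf R => (f : {ptws nat -> R})).

HB.instance Definition _ := Topological.on linf_prod.

Definition prod_continuous_on_ball (S : linf R -> linf R) : Prop :=
  {within [set f : linf_prod | `|f : linf R| <= 1],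
    continuous (S : linf_prod -> linf_prod)}.

(* For A a set of indices, l_oo(A) and c_0(A) are represented by the elements of
   l_oo and c_0 that vanish off A; for A cofinite, this extension by zero is what
   identifies l_oo(A) / c_0(A) with l_oo / c_0. *)
Definition vanishes_off (A : set nat) (f : linf R) : Prop :=
  forall n, ~ A n -> f n = 0.

(* g = (\sum_(j in A) b i j * f j)_(i in B), all these series being convergent;
   only the entries b i j with i in B and j in A matter *)
Definition matrix_image (A B : set nat) (b : nat -> nat -> R) (f g : linf R) :
    Prop :=
  vanishes_off B g /\
  forall i, B i ->
    (\sum_(0 <= j < n | j \in A) b i j * f j) @[n --> \oo] --> g i.

Definition bounded_c0_matrix (A B : set nat) (b : nat -> nat -> R) : Prop :=
  exists M : R, forall f : linf R, c0 f -> vanishes_off A f ->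
    exists g : linf R, [/\ c0 g, matrix_image A B b f g & `|g| <= M * `|f| ].

Definition matrix_operator (T : {linear linf_c0 R -> linf_c0 R}) : Prop :=
  exists (A B : set nat) (b : nat -> nat -> R),
    [/\ finite_set (~` A), finite_set (~` B),
        bounded_c0_matrix A B b &
        forall f : linf R, vanishes_off A f ->
          exists g : linf R,
            matrix_image A B b f g /\ T (linf_cls f) = linf_cls g].

End Operators.

(* Main.v *)
From HB Require Import structures.
Require Import Defs.
From mathcomp Require Import all_boot all_order all_algebra.
From mathcomp Require Import all_classical all_reals all_analysis.
From mathcomp Require Import ring lra.
Import numFieldNormedType.Exports.

(** The operator is a rank-one perturbation of the identity. Let [phi] be the
    limit along a nonprincipal ultrafilter, a bounded functional on l_oo that
    extends the limit of convergent sequences. It kills [c0], so it induces a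
    functional [psi] on l_oo / c0, and [T x = x + psi x *: [1]] is bounded, with
    lifting [f |-> f + phi f *: 1]. Since [psi [1] = 1], the map
    [x |-> x - (psi x / 2) *: [1]] is the inverse of [T] ([rank_one_pertK]).

    Suppose that [T [x] = [G x]] for all 0-1 sequences [x], where every
    coordinate of [G x] depends continuously on [x] in Cantor space. Then
    [F x n := G x n - x n] also has continuous coordinates, and [F x n] tends to
    [phi x] as [n] grows; in particular the limit is 0 if [x] ends in zeros and
    1 if [x] ends in ones. As in Steinhaus' theorem, that no regular summation
    method sums all bounded sequences, a gliding hump shows this to be
    impossible ([gliding_hump]): take a finite word followed by zeros, so that
    [F x n] is close to 0 for some [n]; freeze the finitely many entries that
    decide this, continue with ones, so that [F x n] is close to 1 for some
    later [n]; freeze, and so on. On the limiting word [F] oscillates.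

    Both negative claims are instances. A lifting [S] that is continuous on the
    ball gives [G x := S x] ([prod_continuous_cantor]). For a matrix, take
    for [G x] the image of [x] cut down to the columns in [A]; its coordinates
    are continuous because a matrix bounded on [c0] has rows bounded in l_1
    ([bounded_c0_matrix_rows], [summable_row_continuous]). *)

Set Implicit Arguments.
Unset Strict Implicit.
Unset Printing Implicit Defensive.

Section NonMatrixOperator.
Variable R : realType.
Local Open Scope classical_set_scope.
Local Open Scope ring_scope.
Local Open Scope quotient_scope.
Import Order.TTheory GRing.Theory Num.Theory.

(** * The gliding hump *)

(** Continuity of each coordinate on Cantor space [nat -> bool], in the
    finitary form that the inductive construction consumes. *)
Definition cantor_continuous (F : (nat -> bool) -> nat -> R) : Prop :=
  forall x n (e : R), 0 < e -> exists m, forall y,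
    (forall k, (k < m)%N -> y k = x k) -> `|F y n - F x n| < e.

(** A sequence of continuous functions on Cantor space cannot converge
    everywhere to a limit that equals [b] on every word ending in [b]s: words of
    both kinds are dense, so a word can be built on which the sequence comes
    back infinitely often near 0 and near 1. *)
Lemma gliding_hump (F : (nat -> bool) -> nat -> R) :
  cantor_continuous F ->
  (forall x, cvgn (F x)) ->
  (forall x (b : bool), (\forall k \near \oo, x k = b) ->
     F x n @[n --> \oo] --> (b%:R : R)) ->
  False.
Proof.
move=> Fcont Fcvg Ftail.
(* A state [s] holds a word, the length of its frozen prefix, the digit to
   prolong it by, and a lower bound for the index of the next hump. *)
have stepP (s : (nat -> bool) * nat * (bool * nat)) :
    exists t : (nat -> bool) * nat,
    [/\ forall k, (k < s.1.2)%N -> t.1 k = s.1.1 k, (s.1.2 < t.2)%N &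
      exists2 n, (s.2.2 <= n)%N & forall y,
        (forall k, (k < t.2)%N -> y k = t.1 k) -> `|F y n - s.2.1%:R| < 4^-1].
  case: s => [[p m] [b N]] /=.
  pose q k := if (k < m)%N then p k else b.
  have qb : \forall k \near \oo, q k = b.
    by exists m => // k /= mk; rewrite /q ltnNge mk.
  have e8 : (0 : R) < 8^-1 by rewrite invr_gt0.
  have /cvgrPdist_lt/(_ _ e8)[N0 _ HN0] := Ftail q b qb.
  pose n := maxn N N0.
  have [m' Hm'] := Fcont q n _ e8.
  exists (q, (maxn m m').+1); split => /=.
  - by move=> k km; rewrite /q km.
  - by rewrite ltnS leq_maxl.
  - exists n; first exact: leq_maxl.
    move=> y yq.
    have := HN0 n (leq_maxr _ _); rewrite /= distrC => Hq.
    have {}yq : forall k, (k < m')%N -> y k = q k.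
      by move=> k km; apply: yq; rewrite ltnS ltnW// (leq_trans km)// leq_maxr.
    rewrite -(subrK (F q n) (F y n)) -addrA.
    apply: (le_lt_trans (ler_normD _ _)).
    rewrite (_ : 4^-1 = 8^-1 + 8^-1 :> R); last by lra.
    by rewrite ltrD// Hm'.
(* The [k]-th step prolongs by the digit [odd k], at a hump of index at least
   [k]. *)
have [step stepE] := choice stepP.
pose st := fix st k : (nat -> bool) * nat :=
  if k is k'.+1 then step (st k', (odd k', k')) else (fun=> false, 0%N).
have stS k : st k.+1 = step (st k, (odd k, k)) by [].
have st_lt k : ((st k).2 < (st k.+1).2)%N.
  by rewrite stS; case: (stepE (st k, (odd k, k))).
have st_mono k l : (k <= l)%N -> ((st k).2 <= (st l).2)%N.
  move=> /subnKC <-; elim: (l - k)%N => [|d IH]; first by rewrite addn0.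
  by rewrite addnS (leq_trans IH)// ltnW.
have st_gt k : (k <= (st k).2)%N.
  by elim: k => // k IH; exact: leq_ltn_trans (st_lt k).
have st_agree k l : (k <= l)%N -> forall j, (j < (st k).2)%N ->
    (st l).1 j = (st k).1 j.
  move=> /subnKC <- j jk; elim: (l - k)%N => [|d IH]; first by rewrite addn0.
  rewrite addnS -IH stS.
  case: (stepE (st (k + d)%N, (odd (k + d), (k + d)%N))) => + _ _; apply => /=.
  by rewrite (leq_trans jk)// st_mono// leq_addr.
pose y j := (st j.+1).1 j.
have yst k j : (j < (st k).2)%N -> y j = (st k).1 j.
  move=> jk; have [kj|jk'] := leqP k j.+1; first exact: st_agree.
  by rewrite (st_agree _ _ (ltnW jk') j)// st_gt.
have Fy k : exists2 n, (k <= n)%N & `|F y n - (odd k)%:R| < 4^-1.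
  case: (stepE (st k, (odd k, k))) => _ _ [n kn H]; exists n => //.
  by apply: H => j; rewrite -stS; exact: yst.
have e4 : (0 : R) < 4^-1 by rewrite invr_gt0.
have /cvgrPdist_lt/(_ _ e4)[N _ HN] := Fcvg y.
have [n0 Nn0] := Fy N.*2; have [n1 Nn1] := Fy N.*2.+1.
rewrite /= odd_double /= => h1 h0.
have {}Nn0 : (N <= n0)%N by rewrite (leq_trans _ Nn0)// -addnn leq_addr.
have {}Nn1 : (N <= n1)%N.
  by rewrite (leq_trans _ Nn1)// ltnW// ltnS -addnn leq_addr.
have := HN _ Nn0; have := HN _ Nn1; move: h0 h1; rewrite /= !ltr_norml.
by do 4! move=> /andP[? ?]; lra.
Qed.

(** * Continuity on the ball *)

Lemma linf_prod_cvg (g : nat -> linf R) (f : linf R) :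
  (forall k, g n k @[n --> \oo] --> (f k : R)) ->
  (g n : linf_prod R) @[n --> \oo] --> (f : linf_prod R).
Proof.
move=> gf.
have /(pointwise_cvgP (fun k => f k)) gf' : forall k : nat,
    (fun h : nat -> R => h k) @ ((fun n => (g n : nat -> R)) @ \oo) --> f k.
  exact: gf.
move=> A /=; rewrite nbhsE => -[B [[C oC <-] Cf] BA].
rewrite nbhs_filterE; apply: filterS BA _.
by apply: gf'; exact: open_nbhs_nbhs.
Qed.

Lemma linf_prod_coord_continuous (k : nat) :
  continuous ((fun f : linf R => f k) : linf_prod R -> R).
Proof.
move=> f.
have h := @initial_continuous (linf R) {ptws nat -> R}
  (fun f : linf R => (f : {ptws nat -> R})) f.
have p := @proj_continuous nat (fun=> R) k (f : nat -> R).
exact: (cvg_comp _ _ h p).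
Qed.

Lemma zero_one_bounded (x : nat -> bool) :
  (fun n => (x n)%:R) \in bounded_seq (R := R).
Proof.
by apply/bounded_seqP; exists 1 => n; rewrite normr_nat lern1; case: (x n).
Qed.

Definition zero_one (x : nat -> bool) : linf R := Linf (zero_one_bounded x).

Lemma zero_one_ball x : `|zero_one x| <= 1.
Proof. by apply: linf_norm_le => n; rewrite normr_nat lern1; case: (x n). Qed.

(** Words that agree with [x] on longer and longer prefixes converge to [x]
    coordinatewise within the ball, so continuity can be tested along them; this
    avoids a description of the neighbourhoods in the product topology. *)
Lemma prod_continuous_cantor (S : linf R -> linf R) :
  prod_continuous_on_ball S ->
  cantor_continuous (fun x => S (zero_one x) : nat -> R).
Proof.
move=> Sc x n e e0; apply: contrapT => /forallNP Hm.
have {}Hm m : exists y, (forall k, (k < m)%N -> y k = x k) /\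
    e <= `|S (zero_one y) n - S (zero_one x) n|.
  have /existsNP[y /not_implyP[yx /negP]] := Hm m.
  by rewrite -leNgt => he; exists y.
have [y yP] := choice Hm.
have yx : (zero_one (y m) : linf_prod R) @[m --> \oo] -->
    (zero_one x : linf_prod R).
  apply: linf_prod_cvg => k; apply: cvg_near_cst.
  by exists k.+1 => // m /= km; rewrite (yP m).1.
have ball z : [set f : linf_prod R | `|f : linf R| <= 1] (zero_one z).
  exact: zero_one_ball.
have /subspace_continuousP/(_ _ (ball x)) Sx := Sc.
have yxw : (zero_one (y m) : linf_prod R) @[m --> \oo] -->
    within [set f : linf_prod R | `|f : linf R| <= 1]
      (nbhs (zero_one x : linf_prod R)).
  move=> A /yx yA.
  apply: (@filterS nat \oo _ _ ((fun m => zero_one (y m)) @^-1` A) _ yA) => m.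
  by apply; exact: zero_one_ball.
have := cvg_comp _ _ (cvg_comp _ _ yxw Sx)
  (@linf_prod_coord_continuous n (S (zero_one x))).
move=> /cvgrPdist_lt/(_ _ e0)[N _ /(_ N (leqnn N))] /=.
by rewrite distrC ltNge (yP N).2.
Qed.

(** * Matrices bounded on the null sequences *)

(** Apply the matrix to the signs of a finite part of row [i]: this is a
    finitely supported sequence of norm at most 1, and entry [i] of its image is
    the l_1 norm of that part. *)
Lemma bounded_c0_matrix_rows (A B : set nat) (b : nat -> nat -> R) :
  bounded_c0_matrix A B b ->
  exists M, forall i n, B i -> \sum_(0 <= j < n | j \in A) `|b i j| <= M.
Proof.
move=> [M HM]; exists `|M| => i n Bi.
pose s j : R := if (j < n)%N && (j \in A) then Num.sg (b i j) else 0.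
have s1 j : `|s j| <= 1.
  by rewrite /s; case: ifP => _; rewrite ?normr0// normr_sg lern1; case: eqP.
have sb : s \in bounded_seq (R := R) by apply/bounded_seqP; exists 1.
pose f := Linf sb.
have f0 : c0 f.
  apply: cvg_near_cst; exists n => // j /= nj.
  by rewrite /s ltnNge nj.
have fA : vanishes_off A f.
  by move=> j Aj; rewrite /= /s [j \in A]memNset// andbF.
have [g [_ [_ gi] gM]] := HM f f0 fA.
have gE : g i = \sum_(0 <= j < n | j \in A) `|b i j|.
  have /cvg_lim <- // := gi i Bi.
  apply/cvg_lim => //; apply: cvg_near_cst; exists n => // k /= nk.
  rewrite (big_cat_nat _ (n := n))//= [X in _ + X]big_nat_cond [X in _ + X]big1.
    rewrite addr0 [LHS]big_nat_cond [RHS]big_nat_cond.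
    apply: eq_bigr => j /andP[/andP[_ jn] jA].
    by rewrite /s jn jA mulrC -normrEsg.
  by move=> j /andP[/andP[nj _] _]; rewrite /s ltnNge nj mulr0.
rewrite -gE (le_trans (ler_norm _))// (le_trans (le_linf_norm g i))//.
rewrite (le_trans gM)// (le_trans (ler_wpM2r (normr_ge0 f) (ler_norm M)))//.
by rewrite ler_piMr//; exact: linf_norm_le.
Qed.

Lemma cvg_norm_le (T : Type) (F : set_system T) (u : T -> R) (l M : R) :
  ProperFilter F -> (\forall t \near F, `|u t| <= M) -> u @ F --> l ->
  `|l| <= M.
Proof.
move=> FF uM ul.
have clI : closed (`[- M, M]%classic : set R) by exact: interval_closed.
have segu : \forall t \near F, `[- M, M]%classic (u t).
  by apply: filterS uM => t; rewrite /= in_itv /= -ler_norml.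
have := closed_cvg _ clI segu _ ul.
by rewrite /= in_itv /= -ler_norml => h; exact: h.
Qed.

(** Beyond the index [m] at which the tail of the row has mass at most [e],
    changing the argument by at most 1 changes the sum by at most [e]. *)
Lemma summable_row_continuous (A : set nat) (r : nat -> R) (M e : R) :
  (forall n, \sum_(0 <= j < n | j \in A) `|r j| <= M) -> 0 < e ->
  exists m, forall (u v : nat -> R) (lu lv : R),
    (forall j, (j < m)%N -> u j = v j) -> (forall j, `|u j - v j| <= 1) ->
    (\sum_(0 <= j < n | j \in A) r j * u j) @[n --> \oo] --> lu ->
    (\sum_(0 <= j < n | j \in A) r j * v j) @[n --> \oo] --> lv ->
    `|lu - lv| <= e.
Proof.
move=> rM e0; pose s n := \sum_(0 <= j < n | j \in A) `|r j|.
have sE n k : (n <= k)%N -> s k = s n + \sum_(n <= j < k | j \in A) `|r j|.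
  by move=> nk; rewrite /s -big_cat_nat.
have s_mono : nondecreasing_seq s.
  by move=> n k nk; rewrite (sE _ _ nk) lerDl; apply: sumr_ge0.
have s_cvg : cvgn s.
  by apply: nondecreasing_is_cvgn => //; exists M => _ [n _ <-]; exact: rM.
have /cvgrPdist_le/(_ _ e0)[m _ Hm] := s_cvg.
exists m => u v lu lv uv uv1 cu cv.
apply: cvg_norm_le (cvgB cu cv); exists m => // k /= mk.
rewrite -[X in `|X|]/(\sum_(0 <= j < k | j \in A) r j * u j -
                      \sum_(0 <= j < k | j \in A) r j * v j).
rewrite -sumrB; under eq_bigr do rewrite -mulrBr.
rewrite (big_cat_nat _ (n := m))//= big_nat_cond big1 ?add0r; last first.
  by move=> j /andP[/andP[_ jm] _]; rewrite uv// subrr mulr0.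
rewrite (le_trans (ler_norm_sum _ _ _))//.
apply: (@le_trans _ _ (s k - s m)).
  rewrite (sE _ _ mk) addrAC subrr add0r.
  by apply: ler_sum => j _; rewrite normrM ler_piMr.
apply: le_trans (Hm m (leqnn m)); rewrite (le_trans _ (ler_norm _))//.
by rewrite lerD2r; exact: nondecreasing_cvgn_le.
Qed.

Lemma finite_set_near_infty (A : set nat) :
  finite_set (~` A) -> \forall n \near \oo, A n.
Proof.
move=> /finite_seqP [s sE].
exists (\max_(i <- s) i).+1 => // n /= sn; apply: contrapT => nA.
have /= ns : n \in s by have : (~` A) n by []; rewrite sE.
by move: sn; rewrite ltnNge leq_bigmax_seq.
Qed.

(** * Limits along an ultrafilter *)

(** A bounded sequence has a cluster point along the ultrafilter, by
    compactness; an ultrafilter decides the preimage of each neighbourhood of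
    that point, hence converges to it. *)
Lemma ultrafilter_bounded_cvg (U : set_system nat) (f : linf R) :
  UltraFilter U -> cvg (f n @[n --> U]).
Proof.
move=> UU.
have : compact (`[- `|f|, `|f|]%classic : set R) by exact: segment_compact.
have fUF : ProperFilter (f @ U) by exact: fmap_proper_filter.
have segf : U (f @^-1` `[- `|f|, `|f|]%classic).
  apply: filterE => n; rewrite /= in_itv /= -ler_norml.
  exact: (le_linf_norm f n).
move=> /(_ _ fUF segf)[p [_ fp]].
apply/cvg_ex; exists p => B pB.
have [//|UB] := in_ultra_setVsetC (f @^-1` B) UU.
have [] := fp (~` B) B UB pB.
by move=> z [].
Qed.

Section UltrafilterLimit.
Variable U : set_system nat.
Hypothesis UU : UltraFilter U.
Hypothesis Uinfty : \oo `<=` U.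

Definition ulim (f : linf R) : R := lim (f n @[n --> U]).

Lemma ulimDZ (a : R) f g : ulim (a *: f + g) = a * ulim f + ulim g.
Proof.
rewrite /ulim; apply/cvg_lim; first exact: Rhausdorff.
apply: cvgD; last exact: ultrafilter_bounded_cvg.
by apply: cvgMr; exact: ultrafilter_bounded_cvg.
Qed.

Lemma ulim_norm_le f : `|ulim f| <= `|f|.
Proof.
apply: (cvg_norm_le _ _ (@ultrafilter_bounded_cvg U f UU)).
by apply: filterE => n; exact: (le_linf_norm f n).
Qed.

(** The inclusion [Uinfty] says that the ultrafilter is nonprincipal; it makes
    [ulim] an extension of the ordinary limit, so [ulim] kills [c0]. *)
Lemma ulim_eq_lim (f : linf R) (l : R) :
  f n @[n --> \oo] --> l -> ulim f = l.
Proof.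
move=> fl; apply/cvg_lim; first exact: Rhausdorff.
by move=> A /fl; exact: Uinfty.
Qed.

Definition ulim_quot (x : linf_c0 R) : R := ulim (repr x).

Lemma ulimB f g : ulim (f - g) = ulim f - ulim g.
Proof. by rewrite addrC -scaleN1r ulimDZ// mulN1r addrC. Qed.

Lemma ulim_quotE f : ulim_quot (linf_cls f) = ulim f.
Proof.
apply/eqP; rewrite -subr_eq0 /ulim_quot -ulimB; apply/eqP.
apply: ulim_eq_lim => //.
have : c0 (repr (linf_cls f) - f) by apply/linf_clsP; exact: reprK.
exact.
Qed.

Lemma ulim_quotDZ (a : R) x y :
  ulim_quot (a *: x + y) = a * ulim_quot x + ulim_quot y.
Proof.
have [f <-] := linf_cls_surj x; have [g <-] := linf_cls_surj y.
by rewrite -linearP !ulim_quotE ulimDZ.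
Qed.

Lemma ulim_quot_norm_le x : `|ulim_quot x| <= `|x|.
Proof.
apply: lb_le_inf; first by case: (linf_c0_has_inf x).
by move=> _ [f <- <-]; rewrite ulim_quotE; exact: ulim_norm_le.
Qed.

(** * The rank-one perturbation of the identity *)

Definition one_seq : linf R := zero_one (fun=> true).
Definition one_cls : linf_c0 R := linf_cls one_seq.

Lemma ulim_quot_one : ulim_quot one_cls = 1.
Proof.
rewrite ulim_quotE; apply: ulim_eq_lim => //; exact: cvg_cst.
Qed.

Definition rank_one_pert (c : R) (x : linf_c0 R) : linf_c0 R :=
  x + (c * ulim_quot x) *: one_cls.

Lemma rank_one_pert_linear c : linear (rank_one_pert c).
Proof.
move=> a x y; rewrite /rank_one_pert ulim_quotDZ scalerDr scalerA addrACA.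
by rewrite -scalerDl mulrDr (mulrCA a).
Qed.

HB.instance Definition _ c := GRing.isLinear.Build R (linf_c0 R) (linf_c0 R) _
  (rank_one_pert c) (rank_one_pert_linear c).

Lemma rank_one_pert_bounded c : bounded_operator (rank_one_pert c).
Proof.
exists (1 + `|c| * `|one_cls|) => x.
rewrite (le_trans (ler_normD _ _))// mulrDl mul1r lerD2l normrZ normrM.
by rewrite mulrAC ler_wpM2l ?mulr_ge0// ulim_quot_norm_le.
Qed.

(** Since [ulim_quot one_cls = 1], these perturbations compose as the scalars
    [1 + c] multiply, and [c + d + c * d = 0] means [(1 + c) * (1 + d) = 1]. *)
Lemma rank_one_pertK c d : c + d + c * d = 0 ->
  cancel (rank_one_pert c) (rank_one_pert d).
Proof.
move=> cd x; rewrite {1}/rank_one_pert [X in d * ulim_quot X]/rank_one_pert.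
rewrite addrC [X in ulim_quot X]addrC ulim_quotDZ ulim_quot_one mulr1.
rewrite /rank_one_pert addrCA -scalerDl.
rewrite [X in X *: _](_ : _ = (c + d + c * d) * ulim_quot x); last by ring.
by rewrite cd mul0r scale0r addr0.
Qed.

Definition rank_one_lift (c : R) (f : linf R) : linf R :=
  f + (c * ulim f) *: one_seq.

Lemma rank_one_lift_linear c : linear (rank_one_lift c).
Proof.
move=> a x y; rewrite /rank_one_lift ulimDZ// scalerDr scalerA addrACA.
by rewrite -scalerDl mulrDr (mulrCA a).
Qed.

HB.instance Definition _ c := GRing.isLinear.Build R (linf R) (linf R) _
  (rank_one_lift c) (rank_one_lift_linear c).

Lemma rank_one_liftP c : lifting (rank_one_pert c) (rank_one_lift c).
Proof.
split.
- exists (1 + `|c| * `|one_seq|) => f.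
  rewrite (le_trans (ler_normD _ _))// mulrDl mul1r lerD2l normrZ normrM.
  by rewrite mulrAC ler_wpM2l ?mulr_ge0// ulim_norm_le.
- move=> _ [f f0 <-]; rewrite /= /rank_one_lift.
  have -> : ulim f = 0 by exact: ulim_eq_lim.
  by rewrite mulr0 scale0r addr0.
- move=> f.
  by rewrite /= /rank_one_pert ulim_quotE /rank_one_lift linearD linearZ.
Qed.

(** Any two representatives of [T [x]] differ by a null sequence, so
    [G x n - x n] must converge to the ultrafilter limit of [x]; on words that
    are eventually constant this is the ordinary limit, and the gliding hump
    applies. *)
Lemma rank_one_pert_not_cantor_continuous (G : (nat -> bool) -> linf R) :
  (forall x, rank_one_pert 1 (linf_cls (zero_one x)) = linf_cls (G x)) ->
  ~ cantor_continuous (fun x => G x : nat -> R).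
Proof.
move=> TG Gc.
have Fcvg x : (G x - zero_one x) n @[n --> \oo] --> (ulim (zero_one x) : R).
  have := TG x; rewrite /rank_one_pert ulim_quotE mul1r -linearZ -linearD /=.
  move=> /esym/linf_clsP; rewrite opprD addrA => h.
  apply/cvgrPdist_lt => e e0; move/cvgrPdist_lt: h => /(_ _ e0).
  apply: filterS => n.
  rewrite /= -[X in `|X|]/(0 - (G x n - (x n)%:R - ulim (zero_one x) * 1)).
  by rewrite mulr1 sub0r opprB.
apply: (@gliding_hump (fun x n => (G x - zero_one x) n)) => [x n e e0|x|x b xb].
- have [m Hm] := Gc x n e e0; exists (maxn m n.+1) => y yx.
  rewrite -[X in `|X|]/(G y n - (y n)%:R - (G x n - (x n)%:R)).
  rewrite yx ?leq_maxr// opprB addrA subrK.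
  by apply: Hm => k km; rewrite yx// (leq_trans km)// leq_maxl.
- by apply/cvg_ex; exists (ulim (zero_one x)).
- suff <- : ulim (zero_one x) = b%:R by [].
  apply: ulim_eq_lim => //; apply: cvg_near_cst.
  by apply: filterS xb => k /= ->.
Qed.

(** Cutting [x] down to the cofinite set of columns [A] does not change its
    class, and makes the matrix formula available. *)
Lemma rank_one_pert_not_matrix : ~ matrix_operator (rank_one_pert 1).
Proof.
move=> [A [B [b [Afin Bfin bb bT]]]].
have [M rowM] := bounded_c0_matrix_rows bb.
pose r (x : nat -> bool) j := x j && (j \in A).
have rA x : vanishes_off A (zero_one (r x)).
  by move=> j Aj; rewrite /= /r memNset// andbF.
have [G GE] := choice (fun x => bT _ (rA x)).
apply: (@rank_one_pert_not_cantor_continuous G) => [x|x n e e0].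
  rewrite -(GE x).2; congr (rank_one_pert 1 _); apply/linf_clsP.
  apply: cvg_near_cst; apply: filterS (finite_set_near_infty Afin) => n An.
  rewrite -[LHS]/((x n)%:R - (x n && (n \in A))%:R).
  by rewrite mem_set// andbT subrr.
have [Bn|Bn] := pselect (B n); last first.
  by exists 0%N => y _; rewrite !(GE _).1.1// subrr normr0.
have e20 : 0 < e / 2 by rewrite divr_gt0.
have [m Hm] := summable_row_continuous (fun k => rowM n k Bn) e20.
exists m => y yx; apply: (@le_lt_trans _ _ (e / 2)); last by lra.
apply: (Hm (zero_one (r y)) (zero_one (r x))).
- by move=> j jm; rewrite /= /r yx.
- move=> j /=; case: (r y j); case: (r x j);
    by rewrite ?subrr ?subr0 ?sub0r ?normrN ?normr1 ?normr0.
- exact: (GE y).1.2.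
- exact: (GE x).1.2.
Qed.

Lemma rank_one_pert_automorphism : automorphism (rank_one_pert 1).
Proof.
split; first exact: rank_one_pert_bounded.
exists (rank_one_pert (- 2^-1)); split; first exact: rank_one_pert_bounded.
  by apply: rank_one_pertK; lra.
by apply: rank_one_pertK; lra.
Qed.

Lemma rank_one_pert_no_continuous_lifting (S : {linear linf R -> linf R}) :
  lifting (rank_one_pert 1) S -> ~ prod_continuous_on_ball S.
Proof.
move=> [_ _ ST] /prod_continuous_cantor.
by apply: rank_one_pert_not_cantor_continuous => x; exact: ST.
Qed.

Lemma nonmatrix_liftable_automorphism :
  exists T : {linear linf_c0 R -> linf_c0 R},
    [/\ automorphism T,
        liftable T,
        forall S : {linear linf R -> linf R},
          lifting T S -> ~ prod_continuous_on_ball S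
      & ~ matrix_operator T].
Proof.
exists (rank_one_pert 1); split.
- exact: rank_one_pert_automorphism.
- by exists (rank_one_lift 1); exact: rank_one_liftP.
- exact: rank_one_pert_no_continuous_lifting.
- exact: rank_one_pert_not_matrix.
Qed.

End UltrafilterLimit.
End NonMatrixOperator.

Theorem proposition4p13 (R : realType) :
  (exists T : {linear linf_c0 R -> linf_c0 R},
    [/\ bounded_operator T,
        liftable T,
        forall S : {linear linf R -> linf R},
          lifting T S -> ~ prod_continuous_on_ball S
      & ~ matrix_operator T]) /\
  (exists T : {linear linf_c0 R -> linf_c0 R},
    [/\ automorphism T,
        liftable T,
        forall S : {linear linf R -> linf R},
          lifting T S -> ~ prod_continuous_on_ball S
      & ~ matrix_operator T]).
Proof.
have [U [UU Uinfty]] := ultraFilterLemma eventually_filter.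
have [T [Taut Tlift Tcont Tmx]] := nonmatrix_liftable_automorphism R UU Uinfty.
by split; exists T; split=> //; case: Taut.
Qed.
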